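(* Consider the two-player pricing game with action sets $[0,\phi_h]$ and payoffs $\mathcal M_i(\phi_1,\phi_2;0)$, $i\in\{1,2\}$ (the regime $\beta=0$). If $f(\phi_b)/2<\rho<1$, then the interval $[\phi_L^*,\phi_R^*]$ is an equilibrium cycle, where $\phi_b:=\max\{\phi\in[0,\phi_h]: f(\phi)+2\phi f'(\phi)\ge 0\}$, and $\phi_L^*$ and $\phi_R^*$ are respectively the maximum value and the maximizer over $[0,\phi_h]$ of $\phi\mapsto(f(\phi)-\rho)\phi/\rho$.
   Context: Fix $\phi_h>0$ and $f:[0,\phi_h]\to\mathbb R$ strictly concave, strictly decreasing and differentiable, with $0<f(\phi)\le 1$ for all $\phi$ and $f(0)=1$. Fix $\Lambda>0$, $e>0$, and let $\rho:=e/\Lambda$. Payoffs: let $m(\phi):=(\Lambda f(\phi)-e)\phi$. If $\phi_1>\phi_2$: - if $f(\phi_1)>2\rho$: $\mathcal M_1=e\phi_1$, $\mathcal M_2=e\phi_2$; - if $\rho<f(\phi_1)\le 2\rho$: $\mathcal M_1=m(\phi_1)$, $\mathcal M_2=e\phi_2$; - if $f(\phi_1)\le\rho$: $\mathcal M_1=0$, $\mathcal M_2=\min\{e,\Lambda f(\phi_2)\}\phi_2$. If $\phi_1=\phi_2$: $\mathcal M_i=e\phi_i$ if $f(\phi_i)>2\rho$, and $\mathcal M_i=\frac{\Lambda}{2}f(\phi_i)\phi_i$ otherwise, $i=1,2$. If $\phi_1<\phi_2$, the roles of the two platforms are interchanged. Here $\mathcal M_i=\mathcal M_i(\phi_1,\phi_2;0)$.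 Equilibrium cycle: a closed interval $[a,b]\subseteq[0,\phi_h]$ is an equilibrium cycle if (i) for any $i\in\{1,2\}$ and any $\phi_{-i}\in[a,b]$ there exists $\phi_i\in[a,b]$ such that $\mathcal M_i(\phi_i,\phi_{-i})>\mathcal M_i(\tilde\phi_i,\phi_{-i})$ for all $\tilde\phi_i\in[0,\phi_h]\setminus[a,b]$; (ii) for any $(\phi_1,\phi_2)\in[a,b]^2$ there exist $i\in\{1,2\}$ and $\phi_i'\in[a,b]$ such that $\mathcal M_i(\phi_i',\phi_{-i})>\mathcal M_i(\phi_i,\phi_{-i})$ and $\mathcal M_i(\phi_i',\phi_{-i})>\mathcal M_i(\tilde\phi_i,\phi_{-i})$ for all $\tilde\phi_i\in[0,\phi_h]\setminus[a,b]$; (iii) no closed interval $[c,d]\subsetneq[a,b]$ satisfies (i) and (ii) (with $[c,d]$ in place of $[a,b]$). Here $-i$ denotes the other player and $\mathcal M_i(x,\phi_{-i})$ is $i$'s payoff when $i$ plays $x$ and the other plays $\phi_{-i}$. *)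

(* Defs.v *)
From Stdlib Require Import Reals.
Open Scope R_scope.

Definition on (a b x : R) : Prop := a <= x <= b.

Definition strictly_decreasing_on (a b : R) (f : R -> R) : Prop :=
  forall x y, on a b x -> on a b y -> x < y -> f y < f x.

Definition strictly_concave_on (a b : R) (f : R -> R) : Prop :=
  forall x y t, on a b x -> on a b y -> x <> y -> 0 < t < 1 ->
    t * f x + (1 - t) * f y < f (t * x + (1 - t) * y).

(* [D_in] is the derivative relative to the interval, hence one-sided at the
   end points; it determines [df] uniquely on [[a, b]] when [a < b]. *)
Definition derivative_on (a b : R) (f df : R -> R) : Prop :=
  forall x, on a b x -> D_in f df (on a b) x.

Definition is_maximum (E : R -> Prop) (m : R) : Prop :=
  E m /\ is_upper_bound E m.

Definition image_on (a b : R) (g : R -> R) (v : R) : Prop :=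
  exists x, on a b x /\ v = g x.

Definition is_maximizer_on (a b : R) (g : R -> R) (x : R) : Prop :=
  on a b x /\ forall y, on a b y -> g y <= g x.

Inductive player : Set := P1 | P2.

Definition opponent (i : player) : player :=
  match i with P1 => P2 | P2 => P1 end.

(* The arguments of a game are always listed as the price of [P1], then the
   price of [P2], whichever player's payoff is considered. *)
Definition game : Type := player -> R -> R -> R.

Definition price (i : player) (phi1 phi2 : R) : R :=
  match i with P1 => phi1 | P2 => phi2 end.

(* Payoff of [i] when [i] plays [x] and the opponent plays [y]. *)
Definition payoff (M : game) (i : player) (x y : R) : R :=
  match i with P1 => M P1 x y | P2 => M P2 y x end.

(* [x] is strictly better for [i] against [y] than every action of
   [[lo, hi]] lying outside [[a, b]]. *)
Definition beats_outside (M : game) (lo hi a b : R) (i : player) (x y : R)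
    : Prop :=
  forall z, on lo hi z -> ~ on a b z -> payoff M i z y < payoff M i x y.

Definition cycle_stable (M : game) (lo hi a b : R) : Prop :=
  forall i y, on a b y ->
    exists x, on a b x /\ beats_outside M lo hi a b i x y.

Definition cycle_unrest (M : game) (lo hi a b : R) : Prop :=
  forall phi1 phi2, on a b phi1 -> on a b phi2 ->
    exists i x, on a b x /\
      payoff M i (price i phi1 phi2) (price (opponent i) phi1 phi2)
        < payoff M i x (price (opponent i) phi1 phi2) /\
      beats_outside M lo hi a b i x (price (opponent i) phi1 phi2).

(* Intervals are nonempty: the empty set satisfies the first two conditions
   vacuously, so allowing it as [[c, d]] would make minimality unsatisfiable.
   Singletons are allowed. *)
Definition equilibrium_cycle (M : game) (lo hi a b : R) : Prop :=
  lo <= a /\ a <= b /\ b <= hi /\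
  cycle_stable M lo hi a b /\
  cycle_unrest M lo hi a b /\
  ~ (exists c d, c <= d /\ a <= c /\ d <= b /\ (c <> a \/ d <> b) /\
       cycle_stable M lo hi c d /\ cycle_unrest M lo hi c d).

Definition pay_high (f : R -> R) (Lambda e p : R) : R :=
  if Rlt_dec (2 * (e / Lambda)) (f p) then e * p
  else if Rlt_dec (e / Lambda) (f p) then (Lambda * f p - e) * p
  else 0.

(* Payoff of the cheaper platform, priced [q], against the price [p > q]:
   when [f p] exceeds [e / Lambda] it is [e * q], whether or not [f p] also
   exceeds [2 * (e / Lambda)]. *)
Definition pay_low (f : R -> R) (Lambda e p q : R) : R :=
  if Rlt_dec (e / Lambda) (f p) then e * q
  else Rmin e (Lambda * f q) * q.

Definition pay_tie (f : R -> R) (Lambda e p : R) : R :=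
  if Rlt_dec (2 * (e / Lambda)) (f p) then e * p
  else Lambda / 2 * f p * p.

Definition pricing_game (f : R -> R) (Lambda e : R) : game :=
  fun i phi1 phi2 =>
    let own := price i phi1 phi2 in
    let other := price (opponent i) phi1 phi2 in
    if Rlt_dec other own then pay_high f Lambda e own
    else if Rlt_dec own other then pay_low f Lambda e other own
    else pay_tie f Lambda e own.

(* Main.v *)
(** Write [g phi = (f phi - rho) * phi / rho], so that the pricier platform earns
    [e * g phi] when [rho < f phi <= 2 * rho]. Strict concavity makes [phiR] the
    only maximizer of [g], and the bound on [f phib] forces [f phiR < 2 * rho],
    that is [phiL < phiR]. Moreover [f < 2 * rho] on all of [[phiL, phiR]]:
    where [f phi >= 2 * rho] one has [phi <= g phi < phiL].
    Hence, inside the interval, a tie at [phi] pays less than [e * phi], the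
    pricier platform strictly prefers [phiR], and an undercutter of [phiR]
    wants to raise its price towards [phiR]. The price [phiR] secures
    [e * phiL], and everything outside the interval yields strictly less.
    A smaller interval [[c, d]] is already unstable against the price [c]:
    tying loses to a slight undercut of [c], and a higher price earns at most
    [e * phiL], which [phiR] (if [d < phiR]) or a price in [(phiL, c)] matches. *)

Require Import Defs.
From Stdlib Require Import Reals Lra.
Open Scope R_scope.

(** * Concave analysis of the margin [(f z - r) * z] *)

(** Were [f x] above the tangent at [y], the chord slope [s] would be smaller than [df y]. By
    concavity the difference quotients from [y] towards [x] stay below [s], so they could not tend
    to [df y]. *)
Lemma strictly_concave_tangent_left (a b : R) (f df : R -> R) (x y : R) :
  strictly_concave_on a b f -> derivative_on a b f df ->
  on a b x -> on a b y -> x < y ->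
  f x <= f y + df y * (x - y).
Proof.
intros Hconc Hdiff Hx Hy Hxy.
destruct (Rle_lt_dec (f x) (f y + df y * (x - y))) as [H|H]; [exact H|exfalso].
set (s := (f y - f x) / (y - x)).
assert (Hs : s * (y - x) = f y - f x) by (unfold s; field; lra).
assert (Hsd : s < df y) by nra.
destruct (Hdiff y Hy (df y - s) ltac:(lra)) as [del [Hdel Hlim]].
set (t := Rmin (1 / 2) (del / (2 * (y - x)))).
assert (Hq : 0 < del / (2 * (y - x))) by (apply Rdiv_lt_0_compat; lra).
assert (Ht0 : 0 < t) by (unfold t; apply Rmin_glb_lt; lra).
assert (Ht1 : t <= 1 / 2) by apply Rmin_l.
assert (Htd : t * (y - x) < del).
{ assert (t <= del / (2 * (y - x))) by apply Rmin_r.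
  assert (del / (2 * (y - x)) * (y - x) = del / 2) by (field; lra).
  nra. }
pose proof (Hconc x y t Hx Hy ltac:(lra) ltac:(lra)) as Hc.
set (z := t * x + (1 - t) * y) in *.
assert (Hzy : z - y = - (t * (y - x))) by (unfold z; ring).
assert (Hpos : 0 < t * (y - x)) by nra.
unfold on in *.
assert (Hz : D_x (on a b) y z).
{ unfold D_x, no_cond, on; repeat split; try lra.
  unfold z; nra. }
assert (Hdist : Rabs (z - y) < del)
  by (rewrite Hzy, Rabs_Ropp, Rabs_pos_eq; lra).
specialize (Hlim z (conj Hz Hdist)).
change (Rabs ((f z - f y) / (z - y) - df y) < df y - s) in Hlim.
apply Rabs_def2 in Hlim; destruct Hlim as [_ Hlim].
set (q := (f z - f y) / (z - y)) in *.
assert (Hqz : q * (z - y) = f z - f y) by (unfold q; field; lra).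
rewrite Hzy in Hqz.
nra.
Qed.

(** The midpoint of two maximizers would do better: since [f] decreases, averaging [f] and the price
    separately loses nothing against averaging the products, and strict concavity adds a strict
    gain. *)
Lemma margin_maximizer_unique (h r : R) (f : R -> R) (x y : R) :
  strictly_concave_on 0 h f -> strictly_decreasing_on 0 h f ->
  (forall z, on 0 h z -> (f z - r) * z <= (f x - r) * x) ->
  on 0 h x -> on 0 h y -> y <> x ->
  (f y - r) * y < (f x - r) * x.
Proof.
intros Hconc Hdecr Hmax Hx Hy Hyx.
destruct (Rlt_le_dec ((f y - r) * y) ((f x - r) * x)) as [H|H]; [exact H|exfalso].
pose proof (Hconc x y (1 / 2) Hx Hy ltac:(lra) ltac:(lra)) as Hc.
set (z := 1 / 2 * x + (1 - 1 / 2) * y) in *.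
unfold on in *.
assert (Hz : 0 <= z <= h) by (unfold z; lra).
assert (Hz0 : 0 < z) by (unfold z; lra).
specialize (Hmax z Hz).
assert (Hslope : (f y - f x) * (y - x) <= 0).
{ destruct (Rtotal_order x y) as [L|[E|L]]; [|lra|].
  - pose proof (Hdecr x y Hx Hy L); nra.
  - pose proof (Hdecr y x Hy Hx L); nra. }
assert ((1 / 2 * f x + (1 - 1 / 2) * f y - r) * z < (f z - r) * z) by nra.
assert ((1 / 2 * f x + (1 - 1 / 2) * f y - r) * z
        = ((f x - r) * x + (f y - r) * y) / 2 - (f y - f x) * (y - x) / 4)
  by (unfold z; field).
lra.
Qed.

(** If [f x >= 2 * r > f b], then [x] lies left of [b], and the tangent at [b], of slope at least
    [- f b / (2 * b)], keeps [f x] too small for [x] to match the margin of [b]. *)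
Lemma margin_maximizer_lt_double (h r : R) (f df : R -> R) (b x : R) :
  strictly_concave_on 0 h f -> strictly_decreasing_on 0 h f ->
  derivative_on 0 h f df ->
  on 0 h b -> f b + 2 * b * df b >= 0 -> f b / 2 < r ->
  on 0 h x -> (f b - r) * b <= (f x - r) * x -> f x < 2 * r.
Proof.
intros Hconc Hdecr Hdiff Hb Hdfb Hfb Hx Hmax.
destruct (Rlt_le_dec (f x) (2 * r)) as [H|H]; [exact H|exfalso].
assert (Hxb : x < b).
{ destruct (Rtotal_order x b) as [L|[->|L]]; [exact L|lra|].
  pose proof (Hdecr b x Hb Hx L); lra. }
pose proof (strictly_concave_tangent_left 0 h f df x b Hconc Hdiff Hx Hb Hxb) as Ht.
unfold on in *.
(* The tangent at [b] gives [2 b (f x) <= f b (3 b - x)]; with maximality of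
   [x], cancelling [b - x] leaves [f b (2 b - x) <= 2 r b]. *)
assert (H1 : 2 * b * f x <= f b * (3 * b - x)) by nra.
assert (H2 : (b - x) * (f b * (2 * b - x)) <= (b - x) * (2 * r * b)).
{ assert (x * (2 * b * f x) <= x * (f b * (3 * b - x))) by nra.
  nra. }
assert (H3 : f b * (2 * b - x) <= 2 * r * b)
  by (apply Rmult_le_reg_l with (b - x); lra).
(* With [2 * r <= f x], [H1] and [H3] give [4 * r * b <= 2 * r * b + f b * b], hence
   [2 * r <= f b]. *)
nra.
Qed.

(** At the witness [(1 - r) * h] the chord of [f] over [[0, h]] has height [r + (1 - r) * f h],
    which exceeds [r]. *)
Lemma margin_pos_point (h r : R) (f : R -> R) :
  strictly_concave_on 0 h f -> 0 < h -> f 0 = 1 -> 0 < f h -> 0 < r < 1 ->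
  exists x, on 0 h x /\ 0 < (f x - r) * x.
Proof.
intros Hconc Hh Hf0 Hfh Hr.
exists ((1 - r) * h); unfold on; split; [nra|].
pose proof (Hconc h 0 (1 - r)) as Hc; unfold on in Hc.
specialize (Hc ltac:(lra) ltac:(lra) ltac:(lra) ltac:(lra)).
replace ((1 - r) * h + (1 - (1 - r)) * 0) with ((1 - r) * h) in Hc by ring.
rewrite Hf0 in Hc.
apply Rmult_lt_0_compat; nra.
Qed.

(** * Payoffs by the relative position of the two prices *)

Lemma payoff_pricing_game (f : R -> R) (Lambda e : R) (i : player) (x y : R) :
  payoff (pricing_game f Lambda e) i x y =
  if Rlt_dec y x then pay_high f Lambda e x
  else if Rlt_dec x y then pay_low f Lambda e y x
  else pay_tie f Lambda e x.
Proof. now destruct i. Qed.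

Lemma payoff_above (f : R -> R) (Lambda e : R) (i : player) (x y : R) :
  y < x -> e / Lambda < f x < 2 * (e / Lambda) ->
  payoff (pricing_game f Lambda e) i x y = (Lambda * f x - e) * x.
Proof.
intros Hyx Hf; rewrite payoff_pricing_game; unfold pay_high.
repeat destruct Rlt_dec; lra.
Qed.

Lemma payoff_above_rejected (f : R -> R) (Lambda e : R) (i : player) (x y : R) :
  0 < e / Lambda -> y < x -> f x <= e / Lambda ->
  payoff (pricing_game f Lambda e) i x y = 0.
Proof.
intros Hr Hyx Hf; rewrite payoff_pricing_game; unfold pay_high.
repeat destruct Rlt_dec; lra.
Qed.

Lemma payoff_below (f : R -> R) (Lambda e : R) (i : player) (x y : R) :
  x < y -> e / Lambda < f y ->
  payoff (pricing_game f Lambda e) i x y = e * x.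
Proof.
intros Hxy Hf; rewrite payoff_pricing_game; unfold pay_low.
repeat destruct Rlt_dec; lra.
Qed.

Lemma payoff_tie (f : R -> R) (Lambda e : R) (i : player) (x : R) :
  f x < 2 * (e / Lambda) ->
  payoff (pricing_game f Lambda e) i x x = Lambda / 2 * f x * x.
Proof.
intros Hf; rewrite payoff_pricing_game; unfold pay_tie.
repeat destruct Rlt_dec; lra.
Qed.

(** * The equilibrium cycle, derived from properties of the margin *)

(** This isolates the strategic argument: concavity enters only through the strict maximality of the
    margin at [R] and the bounds on [f R]. *)
Lemma equilibrium_cycle_of_margin (h : R) (f : R -> R) (Lambda e L R : R) :
  0 < Lambda -> 0 < e -> strictly_decreasing_on 0 h f ->
  0 < L -> on 0 h R ->
  e / Lambda < f R < 2 * (e / Lambda) ->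
  (Lambda * f R - e) * R = e * L ->
  (forall z, on 0 h z -> z <> R -> (Lambda * f z - e) * z < e * L) ->
  equilibrium_cycle (pricing_game f Lambda e) 0 h L R.
Proof.
intros HLam He Hdecr HL [HR0 HRh] HfR HmR Hmax.
set (r := e / Lambda) in *.
assert (Her : e = Lambda * r) by (unfold r; field; lra).
assert (Hr : 0 < r) by (apply Rdiv_lt_0_compat; assumption).
assert (HLR : L < R).
{ assert (0 < R) by (destruct HR0 as [|<-]; nra).
  assert (Lambda * f R - e < e) by nra.
  nra. }
assert (Hlo : forall z, on L R z -> r < f z).
{ intros z [Hz1 Hz2]; destruct (Req_dec z R) as [->|Hne]; [lra|].
  assert (f R < f z) by (apply Hdecr; unfold on; lra).
  lra. }
assert (Hhi : forall z, on L R z -> f z < 2 * r).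
{ intros z [Hz1 Hz2]; destruct (Req_dec z R) as [->|Hne]; [lra|].
  destruct (Rlt_le_dec (f z) (2 * r)) as [H|H]; [exact H|exfalso].
  specialize (Hmax z ltac:(unfold on; lra) Hne).
  assert (e <= Lambda * f z - e) by nra.
  nra. }
assert (Htie : forall z, on L R z -> Lambda / 2 * f z * z < e * z).
{ intros z Hz; pose proof (Hhi z Hz); destruct Hz.
  assert (Lambda / 2 * f z < e) by nra.
  nra. }
assert (Hout : forall i x y, on L R y ->
  e * L <= payoff (pricing_game f Lambda e) i x y ->
  beats_outside (pricing_game f Lambda e) 0 h L R i x y).
{ intros i x y Hy Hx z Hz Hnz; eapply Rlt_le_trans; [|exact Hx].
  destruct (Rlt_le_dec z L) as [HzL|HzL].
  - rewrite payoff_below; [|destruct Hy; lra|now apply Hlo].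
    nra.
  - assert (HzR : R < z) by (unfold on in Hnz; lra).
    destruct Hz as [Hz0 Hzh].
    assert (f z < f R) by (apply Hdecr; unfold on; lra).
    destruct (Rlt_le_dec r (f z)) as [Hfz|Hfz].
    + rewrite payoff_above; [|destruct Hy; lra|fold r; lra].
      apply Hmax; unfold on; lra.
    + rewrite payoff_above_rejected; [nra|assumption|destruct Hy; lra|assumption]. }
assert (HtopR : forall i y, on L R y -> y < R ->
  payoff (pricing_game f Lambda e) i R y = e * L).
{ intros i y Hy HyR; rewrite payoff_above; [exact HmR|exact HyR|exact HfR]. }
refine (conj _ (conj _ (conj HRh (conj _ (conj _ _))))); try lra.
- intros i y Hy; exists R; split; [unfold on; lra|].
  apply Hout; [exact Hy|].
  destruct (Req_dec y R) as [->|Hne].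
  (* A tie at [R] still pays at least [e * L]: [Lambda * f R < 2 * e] gives
     [Lambda * f R - e <= Lambda / 2 * f R]. *)
  + rewrite payoff_tie by exact (proj2 HfR).
    rewrite <- HmR.
    apply Rmult_le_compat_r; [lra|nra].
  + destruct Hy; rewrite HtopR; unfold on; lra.
- set (unhappy i x y := exists z, on L R z /\
    payoff (pricing_game f Lambda e) i x y
      < payoff (pricing_game f Lambda e) i z y /\
    beats_outside (pricing_game f Lambda e) 0 h L R i z y).
  (* Here [i] is the pricier player; quantifying over [i] settles both strict orders of the prices
     at once. *)
  assert (Hstep : forall i x y, on L R x -> on L R y -> y < x ->
    unhappy i x y \/ unhappy (opponent i) y x).
  { intros i x y Hx Hy Hyx.
    pose proof (Hlo x Hx) as Hfx1; pose proof (Hhi x Hx) as Hfx2.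
    destruct (Req_dec x R) as [->|Hne].
    - right; exists ((y + R) / 2).
      assert (Hz : on L R ((y + R) / 2)) by (unfold on in *; lra).
      split; [exact Hz|split].
      + rewrite !payoff_below by (fold r; lra).
        apply Rmult_lt_compat_l; lra.
      + apply Hout; [exact Hx|].
        rewrite payoff_below by (fold r; lra).
        destruct Hz; apply Rmult_le_compat_l; lra.
    - left; exists R; destruct Hx.
      split; [unfold on; lra|split].
      + rewrite HtopR by (assumption || lra).
        rewrite payoff_above by (fold r; lra).
        apply Hmax; unfold on; lra.
      + apply Hout; [exact Hy|].
        rewrite HtopR by (assumption || lra); lra. }
  intros p1 p2 H1 H2.
  destruct (Rtotal_order p1 p2) as [H12|[<-|H12]].
  + destruct (Hstep P2 p2 p1 H2 H1 H12) as [Hu|Hu]; [exists P2|exists P1]; exact Hu.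
  + exists P1; simpl price.
    pose proof (Htie p1 H1) as Ht; pose proof (Hlo p1 H1) as Hf1.
    pose proof (Hhi p1 H1) as Hf2; pose proof H1 as [HLp HpR].
    (* A tie at [L] leaves no room for undercutting inside the interval, so the deviation is to
       [R]. *)
    destruct (Req_dec p1 L) as [->|Hne].
    * exists R; split; [unfold on; lra|].
      rewrite HtopR by (assumption || lra).
      rewrite payoff_tie by exact Hf2.
      split; [exact Ht|apply Hout; [exact H1|]].
      rewrite HtopR by (assumption || lra); lra.
    (* The second argument of [Rmax] is the undercutting price that merely recovers the tie payoff.
       Any price strictly between [q] and [p1] beats both the tie and [e * L]. *)
    * set (q := Rmax L (Lambda / 2 * f p1 * p1 / e)).
      assert (Hq1 : L <= q) by apply Rmax_l.
      assert (Hq2 : Lambda / 2 * f p1 * p1 <= e * q).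
      { assert (Hm : Lambda / 2 * f p1 * p1 / e <= q) by apply Rmax_r.
        replace (Lambda / 2 * f p1 * p1)
          with (e * (Lambda / 2 * f p1 * p1 / e)) by (field; lra).
        apply Rmult_le_compat_l; lra. }
      assert (Hq3 : q < p1).
      { apply Rmax_lub_lt; [lra|].
        apply Rmult_lt_reg_l with e; [lra|].
        replace (e * (Lambda / 2 * f p1 * p1 / e))
          with (Lambda / 2 * f p1 * p1) by (field; lra).
        exact Ht. }
      exists ((q + p1) / 2); split; [unfold on; lra|].
      split.
      -- rewrite payoff_tie by exact Hf2.
         rewrite payoff_below; [nra|lra|exact Hf1].
      -- apply Hout; [exact H1|].
         rewrite payoff_below; [nra|lra|exact Hf1].
  + destruct (Hstep P1 p1 p2 H1 H2 H12) as [Hu|Hu]; [exists P1|exists P2]; exact Hu.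
- intros [c [d [Hcd [HLc [HdR [Hne [Hst _]]]]]]].
  destruct (Hst P1 c ltac:(unfold on; lra)) as [x [[Hx1 Hx2] Hx]].
  assert (Hc : on L R c) by (unfold on; lra).
  pose proof (Hlo c Hc) as Hfc1; pose proof (Hhi c Hc) as Hfc2.
  destruct (Req_dec x c) as [->|Hxc].
  + pose proof (Htie c Hc) as Ht.
    assert (Hp : 0 < Lambda / 2 * f c * c)
      by (repeat apply Rmult_lt_0_compat; lra).
    (* The undercut now has to leave [[c, d]], so it may fall below [L], and only the break-even
       price bounds it from below. *)
    set (q := Lambda / 2 * f c * c / e).
    assert (Hq : e * q = Lambda / 2 * f c * c) by (unfold q; field; lra).
    assert (Hq0 : 0 < q) by (apply Rdiv_lt_0_compat; assumption).
    assert (Hqc : q < c) by nra.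
    specialize (Hx ((q + c) / 2) ltac:(unfold on; lra) ltac:(unfold on; lra)).
    rewrite payoff_tie in Hx by exact Hfc2.
    rewrite payoff_below in Hx; [nra|lra|exact Hfc1].
  + assert (HxLR : on L R x) by (unfold on; lra).
    assert (Hxv : payoff (pricing_game f Lambda e) P1 x c <= e * L).
    { rewrite payoff_above; [|lra|split; [now apply Hlo|now apply Hhi]].
      destruct (Req_dec x R) as [->|HxR]; [lra|].
      left; apply Hmax; unfold on; lra. }
    (* Since [[c, d]] is a proper subinterval, [d = R] forces [L < c], which leaves room for an
       outside price in [(L, c)]. *)
    destruct (Req_dec d R) as [->|HdR'].
    * assert (HLc' : L < c) by lra.
      specialize (Hx ((L + c) / 2) ltac:(unfold on; lra) ltac:(unfold on; lra)).
      rewrite payoff_below in Hx; [nra|lra|exact Hfc1].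
    * specialize (Hx R ltac:(unfold on; lra) ltac:(unfold on; lra)).
      rewrite HtopR in Hx by (assumption || lra); lra.
Qed.

(** * From the assumptions on [f] and [rho] to the properties of the margin *)

Theorem theorem4 (phih : R) (f df : R -> R) (Lambda e rho : R)
    (phib phiL phiR : R)
    (Hphih : 0 < phih)
    (Hconc : strictly_concave_on 0 phih f)
    (Hdecr : strictly_decreasing_on 0 phih f)
    (Hdiff : derivative_on 0 phih f df)
    (Hrange : forall phi, 0 <= phi <= phih -> 0 < f phi <= 1)
    (Hf0 : f 0 = 1)
    (HLambda : 0 < Lambda) (He : 0 < e) (Hrho : rho = e / Lambda)
    (Hphib : is_maximum
               (fun phi => 0 <= phi <= phih /\ f phi + 2 * phi * df phi >= 0)
               phib)
    (HphiL : is_maximum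
               (image_on 0 phih (fun phi => (f phi - rho) * phi / rho)) phiL)
    (HphiR : is_maximizer_on 0 phih (fun phi => (f phi - rho) * phi / rho) phiR)
    (Hlow : f phib / 2 < rho) (Hhigh : rho < 1) :
  equilibrium_cycle (pricing_game f Lambda e) 0 phih phiL phiR.
Proof.
destruct Hphib as [[Hb Hdfb] _].
destruct HphiL as [[x0 [Hx0 HLx0]] HLub].
destruct HphiR as [HR Hmax].
assert (Hr : 0 < rho) by (rewrite Hrho; apply Rdiv_lt_0_compat; assumption).
assert (Her : e = Lambda * rho) by (rewrite Hrho; field; lra).
assert (HLval : phiL = (f phiR - rho) * phiR / rho).
{ apply Rle_antisym.
  - rewrite HLx0; now apply Hmax.
  - apply HLub; now exists phiR. }
assert (HmR : (f phiR - rho) * phiR = rho * phiL) by (rewrite HLval; field; lra).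
assert (Hmax' : forall z, on 0 phih z -> (f z - rho) * z <= (f phiR - rho) * phiR).
{ intros z Hz; apply Rmult_le_reg_r with (/ rho);
    [now apply Rinv_0_lt_compat|exact (Hmax z Hz)]. }
(* A positive margin somewhere makes the maximal one positive, whence [rho < f phiR] and
   [0 < phiL]. *)
destruct (margin_pos_point phih rho f) as [x1 [Hx1 Hpos]]; try assumption.
{ apply Hrange; lra. }
{ lra. }
specialize (Hmax' x1 Hx1) as Hpos'.
pose proof (margin_maximizer_lt_double phih rho f df phib phiR Hconc Hdecr Hdiff
              Hb Hdfb Hlow HR (Hmax' phib Hb)) as HfR.
assert (HfR' : rho < f phiR) by (destruct HR; nra).
apply equilibrium_cycle_of_margin; try assumption.
- nra.
- rewrite <- Hrho; lra.
- rewrite Her.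
  replace ((Lambda * f phiR - Lambda * rho) * phiR)
    with (Lambda * ((f phiR - rho) * phiR)) by ring.
  rewrite HmR; ring.
- intros z Hz Hne.
  pose proof (margin_maximizer_unique phih rho f phiR z Hconc Hdecr Hmax' HR Hz Hne).
  rewrite Her.
  replace ((Lambda * f z - Lambda * rho) * z)
    with (Lambda * ((f z - rho) * z)) by ring.
  rewrite Rmult_assoc, <- HmR.
  now apply Rmult_lt_compat_l.
Qed.
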